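(* Let $G$ be a finite simple graph. Suppose that $\mathcal{Q}_G$ is normal. Then any two odd holes of $\overline{G}$ without common vertex have a bridge in $\overline{G}$.
   Context: $G$ is a graph on $[n]=\{1,\dots,n\}$; $\overline{G}$ is its complement. A subset $W\subset[n]$ is stable if no two distinct elements of $W$ form an edge of $G$ (the empty set and singletons are stable). With $\rho(W)=\sum_{j\in W}\mathbf{e}_j$, the stable set polytope $\mathcal{Q}_G\subset\mathbb{R}^n$ is the convex hull of the $\rho(W)$ for $W$ stable in $G$. Let $K$ be a field. For an integral convex polytope $\mathcal{P}\subset\mathbb{R}^n$ with $\mathcal{P}\cap\mathbb{Z}^n=\{\mathbf{a}_1,\dots,\mathbf{a}_m\}$, the toric ring $K[\mathcal{P}]$ is the $K$-subalgebra of $K[x_1^{\pm1},\dots,x_n^{\pm1},t]$ generated by the $X^{\mathbf{a}_i}t$ (where $X^{\mathbf{a}}=x_1^{a_1}\cdots x_n^{a_n}$). $\mathcal{P}$ is called normal if $K[\mathcal{P}]$ is a normal domain. A hole of a graph is an induced cycle of length $>3$; it is odd if its length is odd. A bridge of two cycles $C_1$ and $C_2$ in a graph is an edge $\{i,j\}$ of the graph with $i$ a vertex of $C_1$ not in $C_2$ and $j$ a vertex of $C_2$ not in $C_1$. *)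

(* Defs.v *)
From HB Require Import structures.
From mathcomp Require Import all_boot all_order all_algebra.
From mathcomp Require Import classical_sets reals.
From mathcomp Require Import mpoly.

Set Implicit Arguments.
Unset Strict Implicit.
Unset Printing Implicit Defensive.

Import Order.TTheory GRing.Theory Num.Theory.
Local Open Scope classical_set_scope.
Local Open Scope ring_scope.

(* A simple graph on [n] is a symmetric irreflexive relation on 'I_n. *)

Definition compl_graph (n : nat) (G : rel 'I_n) : rel 'I_n :=
  [rel x y | (x != y) && ~~ G x y].

Definition stable (n : nat) (G : rel 'I_n) (W : {set 'I_n}) : Prop :=
  {in W &, forall x y, x != y -> ~~ G x y}.

(* A cycle is the duplicate-free sequence of its vertices in cyclic order; it
   is induced when every edge between its vertices is one of its sides. *)
Definition hole (n : nat) (G : rel 'I_n) (c : seq 'I_n) : Prop :=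
  [/\ ucycle G c, (3 < size c)%N &
      {in c &, forall x y, G x y -> (y == next c x) || (x == next c y)}].

Definition odd_hole (n : nat) (G : rel 'I_n) (c : seq 'I_n) : Prop :=
  hole G c /\ odd (size c).

Definition bridge (n : nat) (G : rel 'I_n) (c1 c2 : seq 'I_n) (i j : 'I_n) :
    Prop :=
  [/\ G i j, i \in c1, i \notin c2, j \in c2 & j \notin c1].

Definition convex_hull (R : realType) (n : nat) (S : set 'rV[R]_n) :
    set 'rV[R]_n :=
  [set x | exists (m : nat) (p : 'I_m -> 'rV[R]_n) (w : 'I_m -> R),
     [/\ forall k, S (p k), forall k, 0 <= w k, \sum_(k < m) w k = 1
       & x = \sum_(k < m) w k *: p k]].

Definition rho (R : realType) (n : nat) (W : {set 'I_n}) : 'rV[R]_n :=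
  \sum_(j in W) delta_mx 0 j.

Definition stable_set_polytope (R : realType) (n : nat) (G : rel 'I_n) :
    set 'rV[R]_n :=
  convex_hull [set x | exists2 W : {set 'I_n}, stable G W & x = rho R W].

Arguments stable_set_polytope R {n} G.

(* The field K(x_1, ..., x_n, t). It contains the Laurent polynomial ring
   K[x_1^+-1, ..., x_n^+-1, t], so the K-subalgebra generated by a set of
   Laurent polynomials, and the fraction field of that subalgebra, can both be
   formed inside it. The last variable of {mpoly K[n.+1]} is t. *)
Notation ratfun K n := {fraction {mpoly K[n.+1]}}.

Definition ratfunC (K : fieldType) (n : nat) (c : K) : ratfun K n :=
  tofrac c%:MP_[n.+1].

Definition xvar (K : fieldType) (n : nat) (i : 'I_n) : ratfun K n :=
  tofrac 'X_(lift ord_max i).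

Definition tvar (K : fieldType) (n : nat) : ratfun K n :=
  tofrac 'X_ord_max.

Definition Xmon (K : fieldType) (n : nat) (a : 'rV[int]_n) : ratfun K n :=
  \prod_(i < n) xvar K i ^ a 0 i.

Inductive subalg_gen (K : fieldType) (n : nat) (S : set (ratfun K n)) :
    ratfun K n -> Prop :=
| SubalgGen f : S f -> subalg_gen S f
| SubalgConst c : subalg_gen S (ratfunC n c)
| SubalgAdd f g : subalg_gen S f -> subalg_gen S g -> subalg_gen S (f + g)
| SubalgMul f g : subalg_gen S f -> subalg_gen S g -> subalg_gen S (f * g).

Definition toric_ring (R : realType) (K : fieldType) (n : nat)
    (P : set 'rV[R]_n) : set (ratfun K n) :=
  subalg_gen [set f | exists2 a : 'rV[int]_n,
                        P (map_mx intr a) & f = Xmon K a * tvar K n].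

Arguments toric_ring {R} K {n} P.

Definition frac_field (L : fieldType) (A : set L) : set L :=
  [set z | exists a b, [/\ A a, A b, b != 0 & z = a / b]].

Definition integral_over (L : fieldType) (A : set L) (z : L) : Prop :=
  exists p : {poly L}, [/\ p \is monic, forall i, A p`_i & root p z].

(* For a subring A of a field L, which is automatically a domain. *)
Definition normal_domain (L : fieldType) (A : set L) : Prop :=
  forall z, frac_field A z -> integral_over A z -> A z.

Definition normal_polytope (R : realType) (K : fieldType) (n : nat)
    (P : set 'rV[R]_n) : Prop :=
  normal_domain (toric_ring K P).

(* Main.v *)
(* If the two holes had no bridge, a clique of the complement would meet at most
   one of them, and each in at most two vertices.  Let the holes have 2k+1 and
   2l+1 vertices and let z be the product of the variables of all these vertices
   times t^(k+l+1).  Then z lies in the fraction field, and z^2 is the product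
   of the generators attached to the edges of the two holes, so z lies in the
   toric ring by normality.  Being a monomial, z is then a product of k+l+1
   generators; but covering the first hole takes at least k+1 cliques, and
   covering the second one l+1 further cliques. *)
From HB Require Import structures.
(* Imported first, because its [symmetric] must not shadow the one on relations. *)
From mathcomp Require Import mpoly.
Require Import Defs.
From mathcomp Require Import all_boot all_order all_algebra.
From mathcomp Require Import classical_sets reals.
From mathcomp Require Import zify ring.

Set Implicit Arguments.
Unset Strict Implicit.
Unset Printing Implicit Defensive.

Import Order.TTheory GRing.Theory Num.Theory.
Local Open Scope ring_scope.

(** * Cycles, and how stable sets meet holes of the complement *)

Lemma perm_map_next (T : eqType) (c : seq T) :
  uniq c -> perm_eq (map (next c) c) c.
Proof.
move=> Uc; have Ui : uniq (map (next c) c).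
  by rewrite map_inj_in_uniq // => x y _ _; apply: (can_inj (prev_next Uc)).
have [||_ e] := uniq_min_size Ui (s2 := c).
- by move=> _ /mapP[x xc ->]; rewrite mem_next.
- by rewrite size_map.
exact: uniq_perm.
Qed.

Lemma next3_neq (T : eqType) (c : seq T) (x : T) :
  uniq c -> (3 < size c)%N -> x \in c -> next c (next c (next c x)) != x.
Proof.
move=> Uc sc xc; case: (rot_to xc) => i s e.
have Us : uniq (x :: s) by rewrite -e rot_uniq.
have ss : (2 < size s)%N by move: sc; rewrite -(size_rot i) e.
rewrite -!(next_rot i Uc) e.
case: s Us ss {e} => [|a [|b [|d s]]] //= /and4P[].
rewrite !inE !negb_or => /and4P[xa xb xd _] /and3P[ab ad _] /andP[bd _] _ _.
by rewrite !(eqxx, negPf xa, negPf xb, eq_sym _ x, eq_sym b a, negPf ab).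
Qed.

(** Members of [W] are pairwise adjacent in the complement, so by inducedness three of them on [c]
    would be pairwise consecutive and close up into a triangle, which [next3_neq] excludes. *)
Lemma stable_hole_count (n : nat) (G : rel 'I_n) (c : seq 'I_n)
    (W : {set 'I_n}) :
  stable G W -> hole (compl_graph G) c -> (count (mem W) c <= 2)%N.
Proof.
move=> sW [/andP[_ Uc] sc ind]; rewrite leqNgt; apply/negP.
rewrite -size_filter.
have : {subset filter (mem W) c <= [pred x | (x \in W) && (x \in c)]}.
  by move=> x; rewrite mem_filter.
have := filter_uniq (mem W) Uc.
case: (filter _ _) => [|x [|y [|z s]]] //=.
rewrite !inE !negb_or -!andbA => /and5P[xy xz _ yz _] sub _.
have /andP[xW xc] : (x \in W) && (x \in c) by apply: sub; rewrite !inE eqxx.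
have /andP[yW yc] : (y \in W) && (y \in c).
  by apply: sub; rewrite !inE eqxx orbT.
have /andP[zW zc] : (z \in W) && (z \in c).
  by apply: sub; rewrite !inE eqxx !orbT.
have adj u v : u \in W -> u \in c -> v \in W -> v \in c -> u != v ->
    (v == next c u) || (u == next c v).
  by move=> uW uc vW vc uv; apply: ind => //; apply/andP; split=> //; apply: sW.
have nI := can_inj (prev_next Uc).
have no3 u v w : u \in c -> v = next c u -> w = next c v -> u = next c w ->
    False.
  by move=> uc -> -> e; have := next3_neq Uc sc uc; rewrite -e eqxx.
(* Of the eight orientations of the three sides, two run round the triangle and contradict [no3]; in
   the other six, two vertices share a successor or a predecessor, or one vertex has two successors,
   so two of the three coincide. *)
case/orP: (adj x y xW xc yW yc xy) => /eqP e1;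
case/orP: (adj y z yW yc zW zc yz) => /eqP e2;
case/orP: (adj x z xW xc zW zc xz) => /eqP e3.
- by rewrite e1 e3 eqxx in yz.
- exact: (no3 x y z).
- by rewrite (nI x z) ?eqxx // -e1 in xz.
- by rewrite (nI x z) ?eqxx // -e1 in xz.
- by rewrite e1 e2 eqxx in xz.
- by rewrite e1 e2 eqxx in xz.
- exact: (no3 x z y).
- by rewrite e2 e3 eqxx in xy.
Qed.

(** * Integer points of the stable set polytope *)

Section StableSetPolytope.
Variables (R : realType) (n : nat) (G : rel 'I_n).

Lemma rhoE (W : {set 'I_n}) i : rho R W 0 i = (i \in W)%:R.
Proof.
rewrite /rho summxE.
under eq_bigr do rewrite mxE eqxx /= eq_sym.
case: (boolP (i \in W)) => iW; last first.
  by rewrite big1 // => j jW; case: eqP jW iW => // -> ->.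
by rewrite (bigD1 i) //= eqxx big1 ?addr0 // => j /andP[_ /negPf->].
Qed.

Lemma rho_in_polytope (W : {set 'I_n}) :
  stable G W -> stable_set_polytope R G (rho R W).
Proof.
move=> sW; exists 1%N, (fun=> rho R W), (fun=> 1).
split=> //; last by rewrite big_ord1 scale1r.
- by move=> _; exists W.
- by rewrite big_ord1.
Qed.

(** A convex combination of numbers at most [b] is at most [b]. Linearity is a hypothesis on a bare
    function, so that explicit coordinate expressions can be plugged in. *)
Lemma polytope_linear_le (f : 'rV[R]_n -> R) (b : R) (x : 'rV[R]_n) :
  linear_for *%R f -> (forall W, stable G W -> f (rho R W) <= b) ->
  stable_set_polytope R G x -> f x <= b.
Proof.
move=> lf fb [m [p [w [Sp w0 w1 ->]]]].
pose fm := GRing.isLinear.Build R _ _ _ f lf.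
pose F : {linear 'rV[R]_n -> R | *%R} := HB.pack f fm.
rewrite -[f]/(F : _ -> _) linear_sum -[b]mul1r -w1 mulr_suml.
apply: ler_sum => k _; rewrite linearZ ler_wpM2l //.
by have [W sW ->] := Sp k; apply: fb.
Qed.

(** The bounds 0 <= x_i <= 1, and x_i + x_j <= 1 on edges, hold at every [rho R W], hence on the
    hull. On integer vectors they already force the indicator of a stable set. *)
Lemma polytope_int_point (a : 'rV[int]_n) :
  stable_set_polytope R G (map_mx intr a) ->
  exists2 W : {set 'I_n}, stable G W & a = \row_i (i \in W)%:R.
Proof.
move=> Pa.
have le01 i : 0 <= a 0 i <= 1.
  have h1 : (map_mx intr a : 'rV[R]_n) 0 i <= 1.
    apply: (polytope_linear_le (f := fun x => x 0 i)) Pa.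
    - by move=> c x y; rewrite !mxE.
    - by move=> W _; rewrite rhoE lern1 leq_b1.
  have h0 : - (map_mx intr a : 'rV[R]_n) 0 i <= 0.
    apply: (polytope_linear_le (f := fun x => - x 0 i)) Pa.
    - by move=> c x y; rewrite !mxE opprD mulrN.
    - by move=> W _; rewrite rhoE oppr_le0.
  by move: h1 h0; rewrite mxE oppr_le0 ler0z lerz1 => -> ->.
have edge i j : i != j -> G i j -> a 0 i + a 0 j <= 1.
  move=> ij Gij.
  have : (map_mx intr a : 'rV[R]_n) 0 i + (map_mx intr a : 'rV[R]_n) 0 j <= 1.
    apply: (polytope_linear_le (f := fun x => x 0 i + x 0 j)) Pa.
    - by move=> c x y; rewrite !mxE; ring.
    - move=> W sW; rewrite !rhoE -natrD lern1.
      case: (boolP (i \in W)) => iW; case: (boolP (j \in W)) => jW //.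
      by have := sW i j iW jW ij; rewrite Gij.
  by rewrite !mxE -intrD lerz1.
exists [set i | a 0 i != 0].
  move=> i j; rewrite !inE => i0 j0 ij; apply/negP => Gij.
  have := edge i j ij Gij; have := le01 i; have := le01 j; lia.
by apply/rowP => i; rewrite !mxE inE; have := le01 i; case: eqP => /=; lia.
Qed.

End StableSetPolytope.

(** * Exponent vectors of the generators *)

Section Monomials.
Variables (K : fieldType) (n : nat).

(** The generators have no negative exponents, so polynomial multi-exponents suffice. The exponent
    of t is always 1, so in a sum of such vectors it counts the summands. *)
Definition stable_mnm (W : {set 'I_n}) : 'X_{1..n.+1} :=
  (\sum_(i in W) U_(lift ord_max i) + U_(ord_max))%MM.

Lemma tofrac_sum_mnm (I : Type) (r : seq I) (P : pred I)
    (m : I -> 'X_{1..n.+1}) :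
  tofrac 'X_[\sum_(i <- r | P i) m i] =
  \prod_(i <- r | P i) tofrac 'X_[m i] :> ratfun K n.
Proof.
rewrite (big_morph (fun m => tofrac 'X_[m] : ratfun K n)
  (id1 := 1) (op1 := *%R)) //.
  by move=> x y; rewrite mpolyXD tofracM.
by rewrite mpolyX0 tofrac1.
Qed.

Lemma tofrac_stable_mnm (W : {set 'I_n}) :
  tofrac 'X_[stable_mnm W] = (\prod_(i in W) xvar K i) * tvar K n.
Proof. by rewrite mpolyXD tofracM tofrac_sum_mnm. Qed.

Lemma Xmon_row (W : {set 'I_n}) :
  Xmon K (\row_i (i \in W)%:R) = \prod_(i in W) xvar K i.
Proof.
rewrite /Xmon [RHS]big_mkcond /=; apply: eq_bigr => i _; rewrite mxE.
by case: (i \in W); rewrite ?expr1z ?expr0z.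
Qed.

Lemma stable_mnm_lift (W : {set 'I_n}) i :
  stable_mnm W (lift ord_max i) = (i \in W).
Proof.
rewrite mnmDE mnm_sumE mnm1E (negPf (neq_lift _ _)) addn0.
under eq_bigr do rewrite mnm1E (inj_eq lift_inj).
case: (boolP (i \in W)) => iW; last first.
  by rewrite big1 // => j jW; case: eqP jW iW => // -> ->.
by rewrite (bigD1 i) //= eqxx big1 ?addn0 // => j /andP[_ /negPf->].
Qed.

Lemma stable_mnm_max (W : {set 'I_n}) : stable_mnm W ord_max = 1%N.
Proof.
rewrite mnmDE mnm_sumE mnm1E eqxx big1 // => j _.
by rewrite mnm1E eq_sym (negPf (neq_lift _ _)).
Qed.

End Monomials.

(** * Membership in the toric ring *)

Section ToricRing.
Variables (R : realType) (K : fieldType) (n : nat) (G : rel 'I_n).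
Notation A := (toric_ring K (stable_set_polytope R G)).

Lemma toric_stable (W : {set 'I_n}) :
  stable G W -> A ((\prod_(i in W) xvar K i) * tvar K n).
Proof.
move=> sW; apply: SubalgGen; exists (\row_i (i \in W)%:R); last by rewrite Xmon_row.
have -> : map_mx intr (\row_i (i \in W)%:R) = rho R W.
  by apply/rowP => i; rewrite rhoE !mxE; case: (i \in W).
exact: rho_in_polytope.
Qed.

Lemma toric1 : A 1.
Proof.
have <- : ratfunC n 1 = 1 :> ratfun K n by rewrite /ratfunC mpolyC1 tofrac1.
exact: SubalgConst.
Qed.

Lemma toric_prod (I : eqType) (r : seq I) (f : I -> ratfun K n) :
  {in r, forall i, A (f i)} -> A (\prod_(i <- r) f i).
Proof.
move=> Af; rewrite big_seq; elim/big_ind: _ => //; first exact: toric1.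
exact: SubalgMul.
Qed.

(** A condition on supports passes to sums and products, since cancellation only shrinks a support.
    It makes any monomial of the ring a product of generators. *)
Lemma toric_support (f : ratfun K n) : A f ->
  exists2 p : {mpoly K[n.+1]}, f = tofrac p &
    {in msupp p, forall m, exists2 Ws : seq {set 'I_n},
       {in Ws, forall W, stable G W} & m = (\sum_(W <- Ws) stable_mnm W)%MM}.
Proof.
elim=> {f} [_ [a Pa ->]|c|f g _ [p -> IHp] _ [q -> IHq]
  |f g _ [p -> IHp] _ [q -> IHq]].
- have [W sW ->] := polytope_int_point Pa.
  exists 'X_[stable_mnm W]; first by rewrite Xmon_row tofrac_stable_mnm.
  move=> m; rewrite msuppX inE => /eqP ->; exists [:: W]; last by rewrite big_seq1.
  by move=> V; rewrite inE => /eqP ->.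
- exists c%:MP => // m; rewrite msuppC; case: ifP => // _.
  by rewrite inE => /eqP ->; exists [::] => //; rewrite big_nil.
- exists (p + q); first by rewrite tofracD.
  by move=> m /msuppD_le; rewrite mem_cat => /orP[/IHp|/IHq].
- exists (p * q); first by rewrite tofracM.
  move=> m /msuppM_le /allpairsP[[m1 m2] /= [/IHp[Vs sV ->] /IHq[Ws sW ->] ->]].
  exists (Vs ++ Ws); last by rewrite big_cat.
  by move=> W; rewrite mem_cat => /orP[/sV|/sW].
Qed.

End ToricRing.

Lemma integral_over_sqrt (L : fieldType) (A : set L) (z : L) :
  A 0 -> A 1 -> A (- z ^+ 2) -> integral_over A z.
Proof.
move=> A0 A1 Az; exists ('X^2 - (z ^+ 2)%:P); split.
- by rewrite monicE lead_coefDl ?lead_coefXn // size_polyN size_polyXn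
    (leq_ltn_trans (size_polyC_leq1 _)).
- move=> i; rewrite coefB coefXn coefC.
  by case: i => [|[|[|i]]] /=; rewrite ?subr0 ?sub0r.
- by rewrite rootE !hornerE subrr.
Qed.

(** Double counting of the pairs of a vertex of [c] and a member of [Ws] containing it: a set that
    meets [c] accounts for at most two vertices. *)
Lemma hole_cover (n : nat) (G : rel 'I_n) (c : seq 'I_n)
    (Ws : seq {set 'I_n}) :
  hole (compl_graph G) c -> {in Ws, forall W, stable G W} ->
  {in c, forall i, (\sum_(W <- Ws) (i \in W) = 1)%N} ->
  (size c <= 2 * count (fun W : {set 'I_n} => has (mem W) c) Ws)%N.
Proof.
move=> hc sW cov.
have -> : size c = (\sum_(W <- Ws) count (mem W) c)%N.
  under [RHS]eq_bigr do rewrite -sum1_count big_mkcond /=.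
  rewrite exchange_big -sum1_size big_seq [RHS]big_seq /=.
  apply: eq_bigr => i ic; rewrite -[LHS](cov i ic).
  by apply: eq_bigr => W _; case: (i \in W).
rewrite -sum1_count big_distrr [X in (_ <= X)%N]big_mkcond /= big_seq.
rewrite [X in (_ <= X)%N]big_seq; apply: leq_sum => W /sW sWW.
case: ifP => [_|]; first exact: stable_hole_count hc.
by rewrite has_count lt0n => /negbFE/eqP ->.
Qed.

(* Summing over sides counts every vertex of the cycle twice. *)
Lemma toric_cycle_sqr (R : realType) (K : fieldType) (n : nat) (G : rel 'I_n)
    (c : seq 'I_n) :
  symmetric G -> ucycle (compl_graph G) c ->
  toric_ring K (stable_set_polytope R G)
    ((\prod_(i <- c) xvar K i) ^+ 2 * tvar K n ^+ size c).
Proof.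
move=> Gsym /andP[cyc Uc].
have -> : (\prod_(i <- c) xvar K i) ^+ 2 * tvar K n ^+ size c =
    \prod_(i <- c) ((\prod_(j in [set i; next c i]) xvar K j) * tvar K n).
  rewrite big_split /= big_const_seq count_predT iter_mulr_1; congr (_ * _).
  transitivity (\prod_(i <- c) (xvar K i * xvar K (next c i))).
    rewrite big_split expr2 /=; congr (_ * _).
    by rewrite -(perm_big _ (perm_map_next Uc)) big_map.
  rewrite big_seq [RHS]big_seq; apply: eq_bigr => i ic.
  have /andP[ne _] := next_cycle cyc ic.
  by rewrite big_setU1 ?inE //= big_set1.
apply: toric_prod => i ic; apply: toric_stable.
have /andP[ne nG] := next_cycle cyc ic.
move=> x y; rewrite !inE => /orP[]/eqP-> /orP[]/eqP->; rewrite ?eqxx //.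
by rewrite Gsym.
Qed.

(** * Two odd holes without a bridge *)

Theorem proposition2p3 (R : realType) (K : fieldType) (n : nat)
    (G : rel 'I_n) (Gsym : symmetric G) (Girr : irreflexive G)
    (Gnormal : normal_polytope K (stable_set_polytope R G))
    (c1 c2 : seq 'I_n)
    (c1hole : odd_hole (compl_graph G) c1)
    (c2hole : odd_hole (compl_graph G) c2)
    (c12disj : forall x : 'I_n, x \in c1 -> x \notin c2) :
  exists i j : 'I_n, bridge (compl_graph G) c1 c2 i j.
Proof.
have [hole1 odd1] := c1hole; have [hole2 odd2] := c2hole.
have [cyc1 _ _] := hole1; have [cyc2 _ _] := hole2.
have c21disj x : x \in c2 -> x \notin c1.
  by move=> x2; apply/negP => /c12disj; rewrite x2.
case: (boolP [exists i, exists j, [&& i \in c1, j \in c2 & compl_graph G i j]]).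
  case/existsP=> i /existsP[j /and3P[i1 j2 ij]]; exists i, j.
  by split=> //; [apply: c12disj | apply: c21disj].
move=> nobridge; exfalso.
have {}nobridge W : stable G W -> has (mem W) c1 -> has (mem W) c2 -> False.
  move=> sW /hasP[i i1 /= iW] /hasP[j j2 /= jW].
  have ij : i != j by apply: contraL j2 => /eqP <-; apply: c12disj.
  move/negP: nobridge; apply; apply/existsP; exists i; apply/existsP; exists j.
  by rewrite i1 j2 !andTb; apply/andP; split=> //; apply: sW.
(* For lengths 2k+1 and 2l+1 this is k+l+1, with no rounding. *)
pose N := (size (c1 ++ c2))./2.
have size2N : size (c1 ++ c2) = (2 * N)%N.
  by rewrite mul2n halfK size_cat oddD odd1 odd2 subn0.
pose A := toric_ring K (stable_set_polytope R G).
pose z := (\prod_(i <- c1 ++ c2) xvar K i) * tvar K n ^+ N.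
have t0 : tvar K n != 0.
  by rewrite tofrac_eq0 -(msupp_eq0) msuppX.
have At : A (tvar K n).
  have := @toric_stable R K n G finset.set0; rewrite big_set0 mul1r; apply.
  by move=> x; rewrite inE.
have Ax i : A (xvar K i * tvar K n).
  have := @toric_stable R K n G [set i]; rewrite big_set1; apply.
  by move=> x y /set1P-> /set1P->; rewrite eqxx.
have Atn m : A (tvar K n ^+ m).
  by elim: m => [|m IH]; [exact: toric1 | rewrite exprS; exact: SubalgMul].
(* The singletons give a numerator with t^(2N). The denominator t^N is in the ring because the empty
   set contributes t itself. *)
have fracz : frac_field A z.
  exists (\prod_(i <- c1 ++ c2) (xvar K i * tvar K n)), (tvar K n ^+ N).
  split; [apply: toric_prod => i _; exact: Ax | exact: Atn | by rewrite expf_neq0 |].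
  rewrite big_split /= big_const_seq count_predT iter_mulr_1 size2N.
  by rewrite mul2n -addnn exprD -mulrA mulfK ?expf_neq0.
have intz : integral_over A z.
  apply: integral_over_sqrt.
  - have <- : ratfunC n 0 = 0 :> ratfun K n by rewrite /ratfunC mpolyC0 tofrac0.
    exact: SubalgConst.
  - exact: toric1.
  - have -> : - z ^+ 2 = ratfunC n (-1) *
        (((\prod_(i <- c1) xvar K i) ^+ 2 * tvar K n ^+ size c1) *
         ((\prod_(i <- c2) xvar K i) ^+ 2 * tvar K n ^+ size c2)).
      rewrite /z /ratfunC mpolyCN mpolyC1 tofracN tofrac1 mulN1r; congr (- _).
      rewrite big_cat /= [RHS]mulrACA -exprD -size_cat size2N mulnC exprM.
      by rewrite !exprMn.
    by apply: SubalgMul; [exact: SubalgConst |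
      apply: SubalgMul; exact: toric_cycle_sqr].
have [p zp supp] := toric_support (Gnormal z fracz intz).
pose m0 := (\sum_(i <- c1 ++ c2) U_(lift ord_max i) + U_(ord_max) *+ N)%MM.
have zm : z = tofrac 'X_[m0].
  by rewrite mpolyXD tofracM tofrac_sum_mnm -mpolyXn tofracXn.
(* As [tofrac] is injective, [p] is the single monomial with exponent [m0]. *)
have [Ws sWs m0E] : exists2 Ws : seq {set 'I_n},
    {in Ws, forall W, stable G W} & m0 = (\sum_(W <- Ws) stable_mnm W)%MM.
  apply: supp; have := zp; rewrite zm => /eqP; rewrite tofrac_eq => /eqP <-.
  by rewrite msuppX inE.
(* Compare the exponents of t. *)
have sizeWs : size Ws = N.
  have := congr1 (fun m : 'X_{1..n.+1} => m ord_max) m0E.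
  rewrite mnmDE mulmnE !mnm_sumE mnm1E eqxx mul1n big1 => [|i _]; last first.
    by rewrite mnm1E eq_sym (negPf (neq_lift _ _)).
  rewrite add0n => ->.
  by under eq_bigr do rewrite stable_mnm_max; rewrite sum1_size.
(* Compare the exponents of x_i; on the left it is 1 because [c1 ++ c2] has no repeated vertex. *)
have cover i : i \in c1 ++ c2 -> (\sum_(W <- Ws) (i \in W) = 1)%N.
  move=> ic; have := congr1 (fun m : 'X_{1..n.+1} => m (lift ord_max i)) m0E.
  rewrite mnmDE mulmnE !mnm_sumE mnm1E (negPf (neq_lift _ _)) mul0n addn0.
  under [X in _ = X -> _]eq_bigr do rewrite stable_mnm_lift.
  move=> <-; under eq_bigr do rewrite mnm1E (inj_eq lift_inj).
  have Uc : uniq (c1 ++ c2).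
    case/andP: cyc1 => _ U1; case/andP: cyc2 => _ U2.
    by rewrite cat_uniq U1 U2 andbT; apply/hasPn.
  rewrite (bigD1_seq i) //= eqxx big1 // => j /negPf.
  by rewrite eq_sym => ->.
have cover1 : {in c1, forall i, (\sum_(W <- Ws) (i \in W) = 1)%N}.
  by move=> i i1; apply: cover; rewrite mem_cat i1.
have cover2 : {in c2, forall i, (\sum_(W <- Ws) (i \in W) = 1)%N}.
  by move=> i i2; apply: cover; rewrite mem_cat i2 orbT.
have := hole_cover hole1 sWs cover1; have := hole_cover hole2 sWs cover2.
set a2 := count _ _; set a1 := count _ _ => le2 le1.
(* By [nobridge] no member of [Ws] is counted in both [a1] and [a2]. *)
have : (a1 + a2 <= size Ws)%N.
  rewrite /a1 /a2 -count_predUI [X in (_ + X)%N](_ : _ = 0%N) ?addn0 ?count_size //.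
  apply/eqP; rewrite -leqn0 leqNgt -has_count; apply/hasPn => W /sWs sW.
  by apply/negP => /andP[]; apply: nobridge.
(* Parity turns 2k+1 <= 2 [a1] into k+1 <= [a1], and likewise l+1 <= [a2], so k+l+2 <= N = k+l+1. *)
move: size2N odd1 odd2 le1 le2; rewrite sizeWs size_cat; lia.
Qed.
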